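(* Consider an interval linear program given by an interval matrix $\mathbf{A}$ and interval vectors $\mathbf{b},\mathbf{c}$. Its duality gap is weakly zero if and only if the primal interval linear program or its dual interval linear program is weakly feasible.
   Context: For real matrices $\underline{A}\le\overline{A}$ in $\mathbb{R}^{m\times n}$ (entrywise order), the interval matrix $\mathbf{A}=[\underline{A},\overline{A}]$ is the set $\{A\in\mathbb{R}^{m\times n}:\underline{A}\le A\le\overline{A}\}$; interval vectors $\mathbf{b}=[\underline b,\overline b]\subseteq\mathbb{R}^m$ and $\mathbf{c}=[\underline c,\overline c]\subseteq\mathbb{R}^n$ are defined analogously. An interval linear program (ILP) is the family of linear programs $\min\{c^{\top}x : x\in\mathcal{M}(A,b)\}$ with $A\in\mathbf{A}$, $b\in\mathbf{b}$, $c\in\mathbf{c}$, where $\mathcal{M}(A,b)\subseteq\mathbb{R}^n$ is described by linear equations and inequalities of a fixed form: each row is of the form $(Ax)_i=b_i$, $(Ax)_i\le b_i$ or $(Ax)_i\ge b_i$, and each variable is free, nonnegative or nonpositive, the same pattern being used for all $(A,b,c)$. A choice $(A,b,c)$ with $A\in\mathbf{A},b\in\mathbf{b},c\in\mathbf{c}$ is called a scenario. The dual ILP is the family of the usual linear programming duals of the scenarios: $\max b^{\top}y$ with $y_i$ free, $\le 0$, $\ge 0$ according to whether row $i$ is an equation, a $\le$ or a $\ge$ inequality, and with $(A^{\top}y)_j= c_j$, $\le c_j$, $\ge c_j$ according to whether $x_j$ is free, nonnegative, nonpositive. An ILP (primal or dual) is weakly feasible if it is feasible for at least one scenario and strongly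 feasible if it is feasible for all scenarios. The duality gap of a linear program is the difference between the primal and dual optimal values; it is zero if and only if at least one of the primal or the dual program is feasible, and it is $\infty$ otherwise. The duality gap of the ILP is weakly zero if at least one scenario has zero duality gap, and strongly zero if all scenarios have zero duality gap. *)

(* Defs.v *)
From HB Require Import structures.
From mathcomp Require Import all_boot all_order all_algebra.
From mathcomp Require Import all_classical all_reals ereal.

Set Implicit Arguments.
Unset Strict Implicit.
Unset Printing Implicit Defensive.

Import Order.TTheory GRing.Theory Num.Theory.
Local Open Scope classical_set_scope.
Local Open Scope ring_scope.

Definition lemx (R : realType) (m n : nat) (A B : 'M[R]_(m, n)) : Prop :=
  forall i j, A i j <= B i j.

(* Interval vectors are one-column interval matrices. *)
Record interval_mx (R : realType) (m n : nat) := IntervalMx {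
  lower : 'M[R]_(m, n);
  upper : 'M[R]_(m, n);
  lower_le_upper : lemx lower upper
}.

Definition in_interval (R : realType) (m n : nat) (I : interval_mx R m n) :
  set 'M[R]_(m, n) := [set A | lemx (lower I) A /\ lemx A (upper I)].

Variant row_kind := RowEq | RowLe | RowGe.
Variant var_kind := VarFree | VarNonneg | VarNonpos.

Definition row_holds (R : realType) (k : row_kind) (lhs rhs : R) : Prop :=
  match k with
  | RowEq => lhs = rhs
  | RowLe => lhs <= rhs
  | RowGe => lhs >= rhs
  end.

Definition var_holds (R : realType) (k : var_kind) (x : R) : Prop :=
  match k with
  | VarFree => True
  | VarNonneg => 0 <= x
  | VarNonpos => x <= 0
  end.

(* Signs are those of the dual of a minimization program. *)
Definition dual_var (k : row_kind) : var_kind :=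
  match k with
  | RowEq => VarFree
  | RowLe => VarNonpos
  | RowGe => VarNonneg
  end.

Definition dual_row (k : var_kind) : row_kind :=
  match k with
  | VarFree => RowEq
  | VarNonneg => RowLe
  | VarNonpos => RowGe
  end.

Definition polyhedron (R : realType) (m n : nat) (rows : 'I_m -> row_kind)
    (vars : 'I_n -> var_kind) (A : 'M[R]_(m, n)) (b : 'cV[R]_m) :
    set 'cV[R]_n :=
  [set x | (forall i, row_holds (rows i) ((A *m x) i 0) (b i 0)) /\
           (forall j, var_holds (vars j) (x j 0))].

Definition primal_set (R : realType) (m n : nat) (rows : 'I_m -> row_kind)
    (vars : 'I_n -> var_kind) (A : 'M[R]_(m, n)) (b : 'cV[R]_m) :
    set 'cV[R]_n :=
  polyhedron rows vars A b.

Definition dual_set (R : realType) (m n : nat) (rows : 'I_m -> row_kind)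
    (vars : 'I_n -> var_kind) (A : 'M[R]_(m, n)) (c : 'cV[R]_n) :
    set 'cV[R]_m :=
  polyhedron (fun j => dual_row (vars j)) (fun i => dual_var (rows i)) A^T c.

(* [+oo] if the primal is infeasible, [-oo] if it is unbounded. *)
Definition primal_value (R : realType) (m n : nat) (rows : 'I_m -> row_kind)
    (vars : 'I_n -> var_kind) (A : 'M[R]_(m, n)) (b : 'cV[R]_m)
    (c : 'cV[R]_n) : \bar R :=
  ereal_inf [set ((c^T *m x) 0 0)%:E | x in primal_set rows vars A b].

(* [-oo] if the dual is infeasible, [+oo] if it is unbounded. *)
Definition dual_value (R : realType) (m n : nat) (rows : 'I_m -> row_kind)
    (vars : 'I_n -> var_kind) (A : 'M[R]_(m, n)) (b : 'cV[R]_m)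
    (c : 'cV[R]_n) : \bar R :=
  ereal_sup [set ((b^T *m y) 0 0)%:E | y in dual_set rows vars A c].

(* The difference of two equal infinite values is read as 0 here, whereas
   [+oo - +oo = -oo - -oo = -oo] in the library; the first branch changes
   nothing for finite values. *)
Definition duality_gap (R : realType) (m n : nat) (rows : 'I_m -> row_kind)
    (vars : 'I_n -> var_kind) (A : 'M[R]_(m, n)) (b : 'cV[R]_m)
    (c : 'cV[R]_n) : \bar R :=
  let p := primal_value rows vars A b c in
  let d := dual_value rows vars A b c in
  if p == d then 0%E else (p - d)%E.

Definition scenario (R : realType) (m n : nat) (IA : interval_mx R m n)
    (Ib : interval_mx R m 1) (Ic : interval_mx R n 1) (A : 'M[R]_(m, n))
    (b : 'cV[R]_m) (c : 'cV[R]_n) : Prop :=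
  [/\ in_interval IA A, in_interval Ib b & in_interval Ic c].

Definition primal_weakly_feasible (R : realType) (m n : nat)
    (rows : 'I_m -> row_kind) (vars : 'I_n -> var_kind)
    (IA : interval_mx R m n) (Ib : interval_mx R m 1)
    (Ic : interval_mx R n 1) : Prop :=
  exists A b c, scenario IA Ib Ic A b c /\ primal_set rows vars A b !=set0.

Definition dual_weakly_feasible (R : realType) (m n : nat)
    (rows : 'I_m -> row_kind) (vars : 'I_n -> var_kind)
    (IA : interval_mx R m n) (Ib : interval_mx R m 1)
    (Ic : interval_mx R n 1) : Prop :=
  exists A b c, scenario IA Ib Ic A b c /\ dual_set rows vars A c !=set0.

Definition gap_weakly_zero (R : realType) (m n : nat)
    (rows : 'I_m -> row_kind) (vars : 'I_n -> var_kind)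
    (IA : interval_mx R m n) (Ib : interval_mx R m 1)
    (Ic : interval_mx R n 1) : Prop :=
  exists A b c, scenario IA Ib Ic A b c /\ duality_gap rows vars A b c = 0%E.

(* Main.v *)
Require Import Defs.
From mathcomp Require Import all_boot all_order all_algebra.
From mathcomp Require Import all_classical all_reals ereal.
From mathcomp Require Import ring lra.

(** The two sides quantify over the same scenarios, so the proposition reduces
to one linear program: its duality gap is zero exactly when the primal or the
dual is feasible ([duality_gap_eq0]). If neither is, the gap is
[+oo - -oo = +oo]. If one of them is, the optimal values must be shown equal,
and weak duality leaves only primal value <= dual value.

Let the primal be feasible. Its value is below [+oo], and [-oo] is below
everything, so let it be a real number [t]; then [t <= c^T x] for all feasible
[x]. A linear inequality valid on a nonempty polyhedron is certified by
multipliers of the constraints ([affine_farkas]); here these form a dual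
feasible [y] with [t <= b^T y], which is the bound sought. Working with values
as infima and suprema, no optimal solution has to be produced.

The certificate comes from a Farkas lemma for homogeneous systems mixing
equations and both senses of inequality ([farkas_rows]), applied to the cone
over the polyhedron: variables [(x, s)] with [s >= 0] and rows compared with
[s b] instead of [b]. Nonemptiness is what makes the inequality survive at
[s = 0], where the points of the cone are recession directions.

If the dual is feasible instead, the dual program is itself rewritten as a
minimization, with data [A^T], [c], [- b]; dualizing it gives back the primal
under [x = - z]. *)

Set Implicit Arguments.
Unset Strict Implicit.
Unset Printing Implicit Defensive.

Import Order.TTheory GRing.Theory Num.Theory.
Local Open Scope classical_set_scope.
Local Open Scope ring_scope.

(** * Farkas' lemma for mixed constraints *)

Lemma multiplier_row_le (R : realType) k (l u b : R) :
  var_holds (dual_var k) l -> row_holds k u b -> l * b <= l * u.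
Proof.
case: k => /= hl hu; first by rewrite hu.
- exact: ler_wnM2l.
- exact: ler_wpM2l.
Qed.

Lemma variable_dual_row_le (R : realType) k (x u c : R) :
  var_holds k x -> row_holds (dual_row k) u c -> u * x <= c * x.
Proof.
case: k => /= hx hu; first by rewrite hu.
- exact: ler_wpM2r.
- exact: ler_wnM2r.
Qed.

(** The value [u] of a violated constraint has a known sign, or is merely
nonzero for an equation, whose multiplier is free. *)
Lemma multiplier_of_violated_row (R : realType) k (l u : R) :
  ~ row_holds k u 0 -> l * u < 0 -> var_holds (dual_var k) l.
Proof.
case: k => //= /negP; rewrite -ltNge => hu.
  by rewrite pmulr_llt0// => /ltW.
by rewrite nmulr_llt0// => /ltW.
Qed.

(** Induction on the constraints, after Bartl. If the head constraint [a i0]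
matters, some [x0] satisfies the others with [g x0 < 0], hence violates [a i0].
The projection [p] along [x0] onto the kernel of [a i0] satisfies the head
constraint whatever its kind, so the induction hypothesis applies to the
functionals composed with [p]. Expanding [p] in the resulting identity leaves
one term in [a i0], and its coefficient has the right sign because
[g x0 < 0 <= l i * a i x0]. Abstract functionals, rather than coefficient
vectors, make this composition immediate. *)
Lemma farkas_rows (R : realType) (W : lmodType R) (I : eqType) (s : seq I)
    (k : I -> row_kind) (a : I -> W -> R) (g : W -> R) :
  uniq s -> (forall i, scalar (a i)) -> scalar g ->
  (forall x, (forall i, i \in s -> row_holds (k i) (a i x) 0) -> 0 <= g x) ->
  exists l : I -> R,
    (forall i, i \in s -> var_holds (dual_var (k i)) (l i)) /\
    forall x, g x = \sum_(i <- s) l i * a i x.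
Proof.
have sc (f : W -> R) : scalar f ->
    forall r x y, f (x - r *: y) = f x - r * f y.
  by move=> hf r x y; rewrite -scaleNr addrC hf mulNr addrC.
elim: s a g => [|i0 s IH] a g /=.
  move=> _ _ hg hpos; exists (fun=> 0); split=> // x; rewrite big_nil.
  have g0 : g 0 = 0 by have := hg (-1) 0 0; rewrite scaler0 addr0 mulN1r addNr.
  have h y : 0 <= g y by exact: hpos.
  apply/eqP; rewrite eq_le h andbT.
  by have := h (0 - 1 *: x); rewrite sc// g0 mul1r sub0r oppr_ge0.
move=> /andP[i0s us] ha hg hpos.
have [hs|] := pselect (forall x,
    (forall i, i \in s -> row_holds (k i) (a i x) 0) -> 0 <= g x).
  (* the constraint i0 is redundant and gets the multiplier 0 *)
  have [l [hl gl]] := IH a g us ha hg hs.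
  exists (fun i => if i == i0 then 0 else l i); split=> [i|x].
    rewrite inE; case: eqVneq => [_ _|_ /= /hl//].
    by case: (k i) => /=.
  rewrite big_cons eqxx mul0r add0r gl; apply: eq_big_seq => i si.
  by case: eqVneq si i0s => // -> ->.
move=> /existsNP[x0 /not_implyP[x0s /negP]]; rewrite -ltNge => gx0.
have ax0 : ~ row_holds (k i0) (a i0 x0) 0.
  move=> h; move: gx0; apply/negP; rewrite -leNgt; apply: hpos => i.
  by rewrite inE => /predU1P[->//|/x0s].
have ax0N : a i0 x0 != 0.
  by apply/eqP => e; apply: ax0; rewrite e; case: (k i0) => /=.
pose p x := x - (a i0 x / a i0 x0) *: x0.
have scp f : scalar f -> scalar (fun x => f (p x)).
  by move=> hf r x y /=; rewrite !sc// hf ha; ring.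
have ap x : a i0 (p x) = 0 by rewrite sc// divfK// subrr.
have [||l [hl gl]] :=
    IH (fun i x => a i (p x)) (fun x => g (p x)) us (fun i => scp _ (ha i)).
- exact: scp.
- move=> x hx; apply: hpos => i; rewrite inE => /predU1P[->|/hx//].
  by rewrite ap; case: (k i0) => /=.
pose q := (g x0 - \sum_(i <- s) l i * a i x0) / a i0 x0.
have q0 : q * a i0 x0 < 0.
  rewrite divfK// subr_lt0 (lt_le_trans gx0)// big_seq sumr_ge0// => i si.
  by rewrite -(mulr0 (l i)) (multiplier_row_le (hl _ si) (x0s _ si)).
exists (fun i => if i == i0 then q else l i); split=> [i|x].
  rewrite inE; case: eqVneq => [-> _|_ /= /hl//].
  exact: multiplier_of_violated_row ax0 q0.
rewrite big_cons eqxx.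
rewrite (_ : \sum_(i <- s) _ = \sum_(i <- s) l i * a i x); last first.
  apply: eq_big_seq => i si.
  by case: eqVneq si i0s => // -> ->.
have : g (p x) = \sum_(i <- s) l i * a i x
    - a i0 x / a i0 x0 * \sum_(i <- s) l i * a i x0.
  rewrite gl mulr_sumr -sumrB; apply: eq_bigr => i _.
  by rewrite /p sc//; ring.
rewrite /p sc// => /eqP; rewrite subr_eq => /eqP ->.
by rewrite /q; field.
Qed.

(** * Sign conditions as rows, and the cone over a polyhedron *)

(** Together with [sign_coef]: the sign condition on a variable [x] written as
the constraint [sign_coef k * x] against 0, so that sign conditions and rows
can be handled by one Farkas lemma. A free variable gives the vacuous
equation [0 = 0]. *)
Definition sign_row (k : var_kind) : row_kind :=
  match k with VarFree => RowEq | VarNonneg => RowGe | VarNonpos => RowLe end.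

Definition sign_coef (R : realType) (k : var_kind) : R :=
  if k is VarFree then 0 else 1.

Lemma sign_rowP (R : realType) k (x : R) :
  row_holds (sign_row k) (sign_coef R k * x) 0 <-> var_holds k x.
Proof. by case: k => /=; rewrite ?mul0r ?mul1r. Qed.

(** The multiplier [l] of a sign condition is the slack in the dual row; for a
free variable the coefficient 0 kills it and the row becomes an equation. *)
Lemma sign_row_slack (R : realType) k (l u c : R) :
  var_holds (dual_var (sign_row k)) l -> c = u + l * sign_coef R k ->
  row_holds (dual_row k) u c.
Proof.
by case: k => /= hl ->; rewrite ?mulr0 ?addr0 ?mulr1 ?lerDl// gerDl.
Qed.

Lemma row_holdsZ (R : realType) k (r u v : R) :
  0 <= r -> row_holds k u v -> row_holds k (r * u) (r * v).
Proof. by case: k => /= r0 => [->//||]; exact: ler_wpM2l. Qed.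

Lemma row_holdsD (R : realType) k (u v u' v' : R) :
  row_holds k u v -> row_holds k u' v' -> row_holds k (u + u') (v + v').
Proof. by case: k => /= => [->->//||]; exact: lerD. Qed.

Lemma row_holds_subr0 (R : realType) k (u v : R) :
  row_holds k (u - v) 0 <-> row_holds k u v.
Proof.
case: k => /=; rewrite ?subr_le0 ?subr_ge0//.
by split=> [/eqP|->]; rewrite ?subrr// subr_eq0 => /eqP.
Qed.

Lemma var_holdsZ (R : realType) k (r u : R) :
  0 <= r -> var_holds k u -> var_holds k (r * u).
Proof. by case: k => //= r0 h; [exact: mulr_ge0|rewrite mulr_ge0_le0]. Qed.

Lemma var_holdsD (R : realType) k (u v : R) :
  var_holds k u -> var_holds k v -> var_holds k (u + v).
Proof. by case: k => //=; [exact: addr_ge0|move=> h1 h2; lra]. Qed.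

(** Taking the dual of the dual reverses every inequality, because [dual_row] and
[dual_var] expect a minimization program and produce the rows and variables of
a maximization program; substituting [- x] for [x] undoes the reversal. *)
Lemma bidual_row (R : realType) k (u v : R) :
  row_holds (dual_row (dual_var k)) u (- v) -> row_holds k (- u) v.
Proof.
by case: k => /= [->||]; [rewrite opprK|rewrite lerNl|rewrite lerNr].
Qed.

Lemma bidual_var (R : realType) k (x : R) :
  var_holds (dual_var (dual_row k)) x -> var_holds k (- x).
Proof. by case: k => //=; [rewrite oppr_ge0|rewrite oppr_le0]. Qed.

Lemma mulmxDZE (R : realType) m n (A : 'M[R]_(m, n)) (x z : 'cV[R]_n) r i :
  (A *m (x + r *: z)) i 0 = (A *m x) i 0 + r * (A *m z) i 0.
Proof. by rewrite mulmxDr -scalemxAr mxE; congr (_ + _); rewrite mxE. Qed.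

Lemma mulmxZE (R : realType) m n (A : 'M[R]_(m, n)) (x : 'cV[R]_n) r i :
  (A *m (r *: x)) i 0 = r * (A *m x) i 0.
Proof. by rewrite -scalemxAr mxE. Qed.

Section LinearProgram.
Context (R : realType) (m n : nat).
Implicit Types (rows : 'I_m -> row_kind) (vars : 'I_n -> var_kind).
Implicit Types (A : 'M[R]_(m, n)) (b y : 'cV[R]_m) (c x : 'cV[R]_n).

Lemma polyhedron_recession rows vars A b x0 x :
  polyhedron rows vars A b x0 -> polyhedron rows vars A 0 x ->
  forall r, 0 <= r -> polyhedron rows vars A b (x0 + r *: x).
Proof.
move=> [h0 h0'] [h h'] r r0; split=> [i|j].
  rewrite mulmxDZE; have := row_holdsZ r0 (h i).
  by rewrite [in X in row_holds _ _ X]mxE mulr0 => /(row_holdsD (h0 i)); rewrite addr0.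
by rewrite 2!mxE; apply: var_holdsD => //; exact: var_holdsZ.
Qed.

Lemma polyhedronZ rows vars A b x r : 0 <= r ->
  polyhedron rows vars A b x -> polyhedron rows vars A (r *: b) (r *: x).
Proof.
move=> r0 [h h']; split=> [i|j].
  by rewrite mulmxZE [(r *: b) _ _]mxE; exact: row_holdsZ.
by rewrite mxE; exact: var_holdsZ.
Qed.

(** For [s > 0] scale back to the polyhedron by [s^-1]; for [s = 0], [x] is a
recession direction, along which an objective bounded below on a nonempty
polyhedron cannot decrease. *)
Lemma homogenized_lower_bound rows vars A b c t x s :
  primal_set rows vars A b !=set0 ->
  (forall z, primal_set rows vars A b z -> t <= (c^T *m z) 0 0) ->
  0 <= s -> polyhedron rows vars A (s *: b) x -> t * s <= (c^T *m x) 0 0.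
Proof.
move=> [x0 hx0] ht; rewrite le_eqVlt => /predU1P[<-|s0] hx.
  rewrite mulr0 leNgt; apply/negP => cx0.
  rewrite scale0r in hx.
  pose d := (c^T *m x0) 0 0 - t.
  have d0 : 0 <= d by rewrite subr_ge0 ht.
  (* far enough along x to lose one unit more than the margin d left at x0 *)
  have r0 : 0 <= (d + 1) / - (c^T *m x) 0 0 by apply: divr_ge0; lra.
  have := ht _ (polyhedron_recession hx0 hx r0).
  rewrite mulmxDZE invrN mulrN mulNr divfK ?lt_eqF//.
  by rewrite /d; lra.
have s1 : 0 <= s^-1 by rewrite invr_ge0 ltW.
have := polyhedronZ s1 hx; rewrite scalerA mulVf ?gt_eqF// scale1r => /ht.
by rewrite mulmxZE mulrC ler_pdivlMr.
Qed.

(** * Duality *)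

(** Comparing coefficients in the Farkas identity for the cone: those of [x]
express [c - A^T y] by the multipliers of the sign conditions, which is dual
feasibility; that of [s] gives [b^T y - t] as the multiplier of [s >= 0]. *)
Lemma affine_farkas rows vars A b c t :
  primal_set rows vars A b !=set0 ->
  (forall x, primal_set rows vars A b x -> t <= (c^T *m x) 0 0) ->
  exists2 y, dual_set rows vars A c y & t <= (b^T *m y) 0 0.
Proof.
move=> ne ht.
pose I := ('I_m + ('I_n + 'I_1))%type.
pose W := ('cV[R]_n * R^o)%type.
pose k (i : I) := match i with
  | inl i => rows i | inr (inl j) => sign_row (vars j) | inr (inr _) => RowGe
  end.
pose a (i : I) (w : W) : R := match i with
  | inl i => (A *m w.1) i 0 - b i 0 * w.2
  | inr (inl j) => sign_coef R (vars j) * w.1 j 0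
  | inr (inr _) => w.2
  end.
pose g (w : W) : R := (c^T *m w.1) 0 0 - t * w.2.
have ha i : scalar (a i).
  move=> r u v; case: i => [i|[j|_]] //=.
    by rewrite [_ *: u.1 + _]addrC mulmxDZE /GRing.scale/=; ring.
  by rewrite 2!mxE; ring.
have hg : scalar g.
  move=> r u v; rewrite /g/= [_ *: u.1 + _]addrC mulmxDZE /GRing.scale/=.
  by ring.
have [w hw|l [hl gl]] := farkas_rows (k := k) (index_enum_uniq I) ha hg.
  rewrite /g subr_ge0.
  have {}hw i : row_holds (k i) (a i w) 0 by apply: hw; rewrite mem_index_enum.
  apply: homogenized_lower_bound ne ht (hw (inr (inr ord0))) _; split=> [i|j].
    rewrite [in X in row_holds _ _ X]mxE mulrC; apply/row_holds_subr0.
    exact: (hw (inl i)).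
  by apply/sign_rowP; exact: (hw (inr (inl j))).
have {}hl i : var_holds (dual_var (k i)) (l i) by apply: hl; rewrite mem_index_enum.
have {}gl w : g w = \sum_i l (inl i) * a (inl i) w +
    (\sum_j l (inr (inl j)) * a (inr (inl j)) w +
     l (inr (inr ord0)) * a (inr (inr ord0)) w).
  by rewrite gl !big_sumType/= big_ord1.
exists (\col_i l (inl i)).
  split=> [j|i]; last by rewrite mxE; exact: (hl (inl i)).
  apply: sign_row_slack (hl (inr (inl j))) _.
  (* the coefficient of x_j *)
  have := gl (delta_mx j 0, 0).
  rewrite /g/= !mulr0 subr0 -colE !mxE addr0 => ->; congr (_ + _).
    by apply: eq_bigr => i _; rewrite mulr0 subr0 -colE !mxE mulrC.
  rewrite (bigD1 j)//= mxE !eqxx mulr1 big1 ?addr0// => j' jj'.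
  by rewrite mxE (negbTE jj') !mulr0.
(* the coefficient of s *)
have := gl (0, 1); rewrite /g/= !mulmx0 mxE sub0r !mulr1.
under eq_bigr do rewrite mxE mulr1 sub0r mulrN.
rewrite sumrN [X in _ + (X + _)]big1 ?add0r; last first.
  by move=> j _; rewrite mxE !mulr0.
have -> : (b^T *m \col_i l (inl i)) 0 0 = \sum_i l (inl i) * b i 0.
  by rewrite mxE; apply: eq_bigr => i _; rewrite !mxE mulrC.
by have /= := hl (inr (inr ord0)); lra.
Qed.

Lemma weak_duality rows vars A b c x y :
  primal_set rows vars A b x -> dual_set rows vars A c y ->
  (b^T *m y) 0 0 <= (c^T *m x) 0 0.
Proof.
move=> [hx hx'] [hy hy'].
have e1 : (b^T *m y) 0 0 <= (y^T *m (A *m x)) 0 0.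
  rewrite !mxE; apply: ler_sum => i _; rewrite !mxE [_ * y i 0]mulrC.
  by apply: multiplier_row_le (hy' i) _; have := hx i; rewrite mxE.
apply: le_trans e1 _; rewrite mulmxA -[y^T *m A]trmxK trmx_mul trmxK.
rewrite !mxE; apply: ler_sum => j _; rewrite !mxE.
by have := variable_dual_row_le (hx' j) (hy j); rewrite mxE.
Qed.

End LinearProgram.

Section StrongDuality.
Context (R : realType) (m n : nat).
Implicit Types (rows : 'I_m -> row_kind) (vars : 'I_n -> var_kind).
Implicit Types (A : 'M[R]_(m, n)) (b y : 'cV[R]_m) (c x : 'cV[R]_n).

(** [affine_farkas] for the dual program seen as minimizing [(- b)^T y]; its
certificate [z] satisfies the primal constraints reversed. *)
Lemma dual_program_farkas rows vars A b c t :
  dual_set rows vars A c !=set0 ->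
  (forall y, dual_set rows vars A c y -> (b^T *m y) 0 0 <= t) ->
  exists2 x, primal_set rows vars A b x & (c^T *m x) 0 0 <= t.
Proof.
move=> ne ht.
have [|z [hz hz'] tz] := affine_farkas (c := - b) (t := - t) ne.
  by move=> y /ht h; rewrite linearN mulNmx [leRHS]mxE lerN2.
exists (- z); last by rewrite mulmxN [leLHS]mxE lerNl.
rewrite trmxK in hz; split=> [i|j].
  rewrite mulmxN [in X in row_holds _ X _]mxE; apply: bidual_row.
  by have := hz i; rewrite [in X in row_holds _ _ X]mxE.
by rewrite mxE; apply: bidual_var; exact: hz'.
Qed.

Lemma dual_value_le_primal_value rows vars A b c :
  (dual_value rows vars A b c <= primal_value rows vars A b c)%E.
Proof.
apply: ge_ereal_sup => _ [y hy <-]; apply: le_ereal_inf_tmp => _ [x hx <-].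
by rewrite lee_fin; exact: weak_duality hx hy.
Qed.

Lemma strong_duality_primal rows vars A b c :
  primal_set rows vars A b !=set0 ->
  primal_value rows vars A b c = dual_value rows vars A b c.
Proof.
move=> ne; apply/eqP; rewrite eq_le dual_value_le_primal_value andbT.
have lb x : primal_set rows vars A b x ->
    (primal_value rows vars A b c <= ((c^T *m x) 0 0)%:E)%E.
  by move=> hx; apply: ereal_inf_lbound; exists x.
case E : (primal_value rows vars A b c) lb => [t| |] lb; last exact: leNye.
  have [x hx|y hy ty] := affine_farkas (c := c) (t := t) ne.
    by rewrite -lee_fin lb.
  by apply: le_ereal_sup_tmp; exists ((b^T *m y) 0 0)%:E; [exists y|].
by case: ne => x /lb; rewrite leye_eq.
Qed.

Lemma strong_duality_dual rows vars A b c :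
  dual_set rows vars A c !=set0 ->
  primal_value rows vars A b c = dual_value rows vars A b c.
Proof.
move=> ne; apply/eqP; rewrite eq_le dual_value_le_primal_value andbT.
have ub y : dual_set rows vars A c y ->
    (((b^T *m y) 0 0)%:E <= dual_value rows vars A b c)%E.
  by move=> hy; apply: ereal_sup_ubound; exists y.
case E : (dual_value rows vars A b c) ub => [t| |] ub; first 1 last.
- exact: leey.
- by case: ne => y /ub; rewrite leeNy_eq.
have [y hy|x hx xt] := dual_program_farkas (b := b) (t := t) ne.
  by rewrite -lee_fin ub.
by apply: ge_ereal_inf; exists ((c^T *m x) 0 0)%:E; [exists x|].
Qed.

Lemma duality_gap_eq0 rows vars A b c :
  duality_gap rows vars A b c = 0%E <->
  primal_set rows vars A b !=set0 \/ dual_set rows vars A c !=set0.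
Proof.
split=> [|[] ne]; last 2 first.
- by rewrite /duality_gap (strong_duality_primal c ne) eqxx.
- by rewrite /duality_gap (strong_duality_dual b ne) eqxx.
move=> gap0; apply: contrapT => /not_orP[/set0P/negP].
rewrite negbK => /eqP p0 /set0P/negP; rewrite negbK => /eqP d0.
move: gap0; rewrite /duality_gap /primal_value /dual_value p0 d0 !image_set0.
by rewrite ereal_inf0 ereal_sup0.
Qed.

End StrongDuality.

Theorem proposition3 (R : realType) (m n : nat)
  (rows : 'I_m -> row_kind) (vars : 'I_n -> var_kind)
  (IA : interval_mx R m n) (Ib : interval_mx R m 1) (Ic : interval_mx R n 1) :
  gap_weakly_zero rows vars IA Ib Ic <->
  (primal_weakly_feasible rows vars IA Ib Ic \/
   dual_weakly_feasible rows vars IA Ib Ic).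
Proof.
split=> [[A [b [c [sc /duality_gap_eq0[ne|ne]]]]]|].
- by left; exists A, b, c.
- by right; exists A, b, c.
- by case=> -[A [b [c [sc ne]]]]; exists A, b, c; split=> //;
    apply/duality_gap_eq0; [left|right].
Qed.
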